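(* Thompson's group $F$ is skew-amenable with respect to the topology of pointwise convergence.
   Context: For a topological group $G$ and $g\in G$ let $\lambda_g\colon G\to G,\ x\mapsto gx$. $\mathrm{LUCB}(G)$ is the algebra of bounded functions $f\colon G\to\mathbb{R}$ that are left-uniformly continuous, i.e., for every $\epsilon>0$ there is a neighborhood $U$ of the neutral element with $|f(x)-f(y)|\le\epsilon$ whenever $x^{-1}y\in U$. A mean on $\mathrm{LUCB}(G)$ is a positive linear functional $\mu$ with $\mu(\mathbf 1)=1$. $G$ is skew-amenable if $\mathrm{LUCB}(G)$ admits a mean $\mu$ with $\mu(f\circ\lambda_g)=\mu(f)$ for all $f\in\mathrm{LUCB}(G)$, $g\in G$. Thompson's group $F$ is the subgroup of $\mathrm{Aut}(\mathbb{Z}[\tfrac12],\leq)$ (order-automorphisms of the dyadic rationals) consisting of those automorphisms which are piecewise affine (with finitely many pieces and breakpoints in $\mathbb{Z}[\tfrac12]$), have all slopes in $\{2^k\mid k\in\mathbb{Z}\}$, and agree with translations by (possibly two different) integers on $(-\infty,-a]\cap\mathbb{Z}[\tfrac12]$ and on $[a,\infty)\cap\mathbb{Z}[\tfrac12]$ for a sufficiently large $a\in\mathbb{Z}[\tfrac12]$. It carries the topology of pointwise convergence induced by its action on the discrete space $\mathbb{Z}[\tfrac12]$, i.e., the subspace topology inherited from $\mathrm{Sym}(\mathbb{Z}[\tfrac12])$ (pointwise stabilizers of finite subsets form a neighborhood basis of the identity). *)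

(* Defs.v *)
From HB Require Import structures.
From mathcomp Require Import all_boot all_order all_algebra.
From mathcomp Require Import ring lra.
From mathcomp Require Import all_classical all_reals all_analysis.

Set Implicit Arguments.
Unset Strict Implicit.
Unset Printing Implicit Defensive.

Import Order.TTheory GRing.Theory Num.Theory.
Import numFieldNormedType.Exports.

Local Open Scope classical_set_scope.
Local Open Scope ring_scope.

HB.mixin Record isTopologicalGroup G & Topological G & Group G := {
  mulg_continuous : continuous (fun x : G * G => (x.1 * x.2)%g);
  invg_continuous : continuous (fun x : G => x^-1%g)
}.

#[short(type="topologicalGroupType")]
HB.structure Definition TopologicalGroup :=
  {G of Topological G & Group G & isTopologicalGroup G}.

Section LUCB.
Variables (R : realType) (G : topologicalGroupType).
Implicit Types f h : G -> R.

Definition left_uniformly_continuous f :=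
  forall e : R, 0 < e -> exists2 U : set G, nbhs (1 : G)%g U &
    forall x y : G, U (x^-1 * y)%g -> `|f x - f y| <= e.

Definition bounded_function f := exists M : R, forall x, `|f x| <= M.

Definition lucb_pred : {pred G -> R} :=
  fun f => `[< bounded_function f /\ left_uniformly_continuous f >].

(* Only the vector space structure of LUCB(G) matters for means, so its
   multiplication is not declared. *)
Record lucb := Lucb { lucb_val :> G -> R; lucbP : lucb_val \in lucb_pred }.

HB.instance Definition _ := [isSub for lucb_val].
HB.instance Definition _ := [Choice of lucb by <:].

Lemma lucb_subsemimod_closed : GRing.subsemimod_closed lucb_pred.
Proof.
split; [split|].
- apply/asboolP; split; first by exists 0 => x; rewrite normr0.
  by move=> e e0; exists setT; [exact: filterT | move=> x y _; rewrite subrr normr0 ltW].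
- move=> f h /asboolP[[M fM] fc] /asboolP[[N hN] hc]; apply/asboolP; split.
    by exists (M + N) => x; apply: le_trans (ler_normD _ _) _; apply: lerD.
  move=> e e0; have e2 : 0 < e / 2 by rewrite divr_gt0.
  have [U U1 Uf] := fc _ e2; have [V V1 Vh] := hc _ e2.
  exists (U `&` V); first exact: filterI.
  move=> x y [Uxy Vxy]; rewrite [e]splitr /= opprD addrACA.
  by apply: le_trans (ler_normD _ _) _; apply: lerD; [exact: Uf | exact: Vh].
- move=> a f /asboolP[[M fM] fc]; apply/asboolP; split.
    by exists (`|a| * M) => x; rewrite normrM ler_wpM2l.
  move=> e e0; have a1 : 0 < `|a| + 1 by rewrite ltr_wpDl.
  have [U U1 Uf] := fc (e / (`|a| + 1)) (divr_gt0 e0 a1).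
  exists U => // x y /Uf fxy; rewrite /= -mulrBr normrM.
  apply: le_trans (ler_wpM2l (normr_ge0 _) fxy) _.
  rewrite mulrCA ler_piMr ?(ltW e0)// ler_pdivrMr// mul1r.
  by rewrite lerDl.
Qed.

HB.instance Definition _ :=
  GRing.SubChoice_isSubLmodule.Build R (G -> R) lucb_pred lucb
    lucb_subsemimod_closed.

Lemma lucb_cst1 : (cst 1 : G -> R) \in lucb_pred.
Proof.
apply/asboolP; split; first by exists 1 => x; rewrite normr1.
by move=> e e0; exists setT; [exact: filterT | move=> x y _; rewrite subrr normr0 ltW].
Qed.

Lemma lucb_lambda (g : G) (f : lucb) :
  (f : G -> R) \o (fun x => g * x)%g \in lucb_pred.
Proof.
have /asboolP[[M fM] fc] := lucbP f.
apply/asboolP; split; first by exists M => x; exact: fM.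
move=> e /fc[U U1 Uf]; exists U => // x y Uxy; apply: Uf.
by rewrite invgM -mulgA mulKg.
Qed.

Definition lucb1 : lucb := Lucb lucb_cst1.

Definition lucb_comp_lambda (g : G) (f : lucb) : lucb := Lucb (lucb_lambda g f).

Definition mean (mu : {scalar lucb}) :=
  (forall f : lucb, (forall x, 0 <= f x) -> 0 <= mu f) /\ mu lucb1 = 1.

Definition skew_amenable :=
  exists2 mu : {scalar lucb}, mean mu &
    forall (f : lucb) (g : G), mu (lucb_comp_lambda g f) = mu f.

End LUCB.

Section Sym.
Variable T : choiceType.

(* Sym(T) is a group under composition, (g * h) x = g (h x), with the subspace
   topology of T -> T for T discrete; nbhs_symP below describes it concretely. *)
Record sym := Sym { sym_fun :> T -> T; _ : `[< bijective sym_fun >] }.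

HB.instance Definition _ := [isSub for sym_fun].
HB.instance Definition _ := [Choice of sym by <:].

Implicit Types g h : sym.

Lemma symP g h : g =1 h -> g = h.
Proof. by move=> gh; apply: val_inj; apply/funext. Qed.

Lemma sym_bij g : bijective g.
Proof. by case: g => g /= /asboolP. Qed.

Lemma id_bij : bijective (@id T).
Proof. by exists id. Qed.

Definition sym1 : sym := Sym (asboolT id_bij).

Definition sym_mul g h : sym :=
  Sym (asboolT (bij_comp (sym_bij g) (sym_bij h))).

Lemma sym_inv_exists g : exists k : T -> T, cancel g k /\ cancel k g.
Proof. by case: (sym_bij g) => k gk kg; exists k. Qed.

Definition sym_inv_fun g : T -> T := projT1 (cid (sym_inv_exists g)).

Lemma sym_funK g : cancel g (sym_inv_fun g).
Proof. exact: (projT2 (cid (sym_inv_exists g))).1. Qed.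

Lemma sym_inv_funK g : cancel (sym_inv_fun g) g.
Proof. exact: (projT2 (cid (sym_inv_exists g))).2. Qed.

Definition sym_inv g : sym :=
  Sym (asboolT (Bijective (@sym_inv_funK g) (@sym_funK g))).

Lemma sym_mulA : associative sym_mul. Proof. by move=> *; apply: symP. Qed.
Lemma sym_mul1 : left_id sym1 sym_mul. Proof. by move=> *; apply: symP. Qed.
Lemma sym_mulr1 : right_id sym1 sym_mul. Proof. by move=> *; apply: symP. Qed.
Lemma sym_mulV : left_inverse sym1 sym_inv sym_mul.
Proof. by move=> g; apply: symP => x; exact: sym_funK. Qed.
Lemma sym_mulrV : right_inverse sym1 sym_inv sym_mul.
Proof. by move=> g; apply: symP => x; exact: sym_inv_funK. Qed.

HB.instance Definition _ :=
  isGroup.Build sym sym_mulA sym_mul1 sym_mulr1 sym_mulV sym_mulrV.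

Lemma sym1E x : (1%g : sym) x = x. Proof. by []. Qed.
Lemma symME g h x : (g * h)%g x = g (h x). Proof. by []. Qed.
Lemma symKV g : cancel g (g^-1)%g. Proof. exact: sym_funK. Qed.
Lemma symVK g : cancel (g^-1)%g g. Proof. exact: sym_inv_funK. Qed.

HB.instance Definition _ := Topological.copy sym
  (initial_topology (sym_fun : sym -> {ptws T -> discrete_topology T})).

Lemma continuous_to_sym (X : topologicalType) (f : X -> sym) :
  (forall t : T, continuous (fun x => f x t : discrete_topology T)) ->
  continuous f.
Proof.
move=> fc; apply: continuous_comp_initial => x.
apply/cvg_sup => t; exact: (@continuous_comp_initial (T -> T) X
  (discrete_topology T) (fun h : T -> T => h t) (sym_fun \o f) (fc t)).
Qed.

Lemma near_sym g (t : T) : nbhs g [set h : sym | h t = g t].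
Proof.
have c1 := @initial_continuous sym {ptws T -> discrete_topology T} (@sym_fun) g.
have c2 := @proj_continuous T (fun=> discrete_topology T) t (sym_fun g).
exact: (c1 _ (c2 _ (discrete_set1 (g t : discrete_topology T)))).
Qed.

Lemma sym_mulg_continuous : continuous (fun x : sym * sym => (x.1 * x.2)%g).
Proof.
apply: continuous_to_sym => t [g h] /=.
apply/(@discrete_cvg (discrete_topology T)).
exists ([set k : sym | k (h t) = g (h t)], [set k : sym | k t = h t]) => /=.
  by split; exact: near_sym.
by move=> [k l] [/= kg lh]; exact: etrans (congr1 k lh) kg.
Qed.

Lemma sym_invg_continuous : continuous (fun g : sym => g^-1%g).
Proof.
apply: continuous_to_sym => t g.
apply/(@discrete_cvg (discrete_topology T)).
  exact: (@fmap_filter _ _ _ _ (nbhs_filter g)).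
apply: filterS (near_sym g ((g^-1)%g t)) => h /= hg.
by apply: (can_inj (symKV h)); rewrite symVK hg symVK.
Qed.

HB.instance Definition _ :=
  isTopologicalGroup.Build sym sym_mulg_continuous sym_invg_continuous.

End Sym.

Lemma nbhs_symP (T : choiceType) (g : sym T) (U : set (sym T)) : nbhs g U <->
  exists s : seq T, [set h : sym T | {in s, forall t, h t = g t}] `<=` U.
Proof.
split=> [|[s sU]]; last first.
  apply: filterS sU _; elim: s => [|t s IH].
    by apply: filterS filterT => h _ t; rewrite in_nil.
  apply: filterS2 (near_sym g t) IH => h /= ht hs u.
  by rewrite inE => /orP[/eqP ->|/hs].
pose B (s : seq T) := [set h : T -> T | {in s, forall t, h t = g t}].
have FB : Filter (filter_from setT B).
  apply: filter_from_filter; first by exists [::].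
  move=> s t _ _; exists (s ++ t) => // h hst; split=> u us; apply: hst;
    by rewrite mem_cat us ?orbT.
have Bg : (filter_from setT B : set_system {ptws T -> discrete_topology T})
    --> (sym_fun g : {ptws T -> discrete_topology T}).
  apply/cvg_sup => t V [_ [[C _ <-] Cg] CV].
  by exists [:: t] => // h hB; apply: CV; rewrite /= hB ?mem_head.
move=> [_ [[C oC <-] Cg] CU].
have [s _ sC] := Bg _ (open_nbhs_nbhs (conj oC Cg)).
by exists s => h hs; apply: CU; exact: sC.
Qed.

Definition dyadic_pred : {pred rat} :=
  fun x => `[< exists (m : int) (n : nat), x = m%:~R / 2 ^+ n >].

Record dyadic := Dyadic { dyadic_val :> rat; _ : dyadic_val \in dyadic_pred }.

HB.instance Definition _ := [isSub for dyadic_val].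
HB.instance Definition _ := [Choice of dyadic by <:].

Lemma dyadic_subring_closed : subring_closed dyadic_pred.
Proof.
split.
- by apply/asboolP; exists 1, 0; rewrite expr0 divr1.
- move=> _ _ /asboolP[m [n ->]] /asboolP[p [q ->]]; apply/asboolP.
  exists (m * 2 ^+ q - p * 2 ^+ n), (n + q)%N.
  rewrite rmorphB !rmorphM !rmorphXn /= exprD.
  by field; rewrite !expf_neq0.
- move=> _ _ /asboolP[m [n ->]] /asboolP[p [q ->]]; apply/asboolP.
  exists (m * p), (n + q)%N.
  by rewrite rmorphM exprD invfM mulrACA.
Qed.

HB.instance Definition _ :=
  GRing.SubChoice_isSubComNzRing.Build rat dyadic_pred dyadic
    dyadic_subring_closed.
HB.instance Definition _ := [SubChoice_isSubOrder of dyadic by <: with ring_display].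

Lemma dyadic_leE (x y : dyadic) : (x <= y) = (val x <= val y).
Proof. by rewrite leEsub. Qed.

Lemma dyadic_ltE (x y : dyadic) : (x < y) = (val x < val y).
Proof. by rewrite ltEsub. Qed.

Implicit Types (g h : sym dyadic) (s : seq dyadic).

Definition order_automorphism g := {mono g : x y / x <= y}.

Definition affine_on (A : set dyadic) g :=
  exists (k : int) (b : rat), forall x, A x -> val (g x) = 2%:Q ^ k * val x + b.

(* For s = [:: b1; ...; bn], pieces -oo s lists the closed pieces
   ]-oo, b1], [b1, b2], ..., [bn, +oo[. *)
Fixpoint pieces (l : itv_bound dyadic) s : seq (interval dyadic) :=
  if s is b :: s' then Interval l (BRight b) :: pieces (BLeft b) s'
  else [:: Interval l +oo%O].

Definition piecewise_affine g :=
  exists2 s : seq dyadic, sorted <%O s &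
    forall I, I \in pieces -oo%O s -> affine_on [set` I] g.

Definition translation_at_infinity g :=
  exists (a : dyadic) (m n : int),
    (forall x, x <= - a -> g x = x + m%:~R) /\
    (forall x, a <= x -> g x = x + n%:~R).

Definition thompson_pred : {pred sym dyadic} := fun g =>
  `[< [/\ order_automorphism g, piecewise_affine g
        & translation_at_infinity g] >].

Definition avoids (A : set dyadic) s :=
  forall b, b \in s -> forall x y, A x -> A y -> ~~ (x < b < y).

Lemma pieces_cover g (A : set dyadic) l s :
  avoids A s -> (forall x, A x -> x \in Interval l +oo%O) ->
  (forall I, I \in pieces l s -> affine_on [set` I] g) -> affine_on A g.
Proof.
elim: s l => [|b s IH] l Av Al P.
  have [k [c kc]] := P _ (mem_head _ _).
  by exists k, c => x Ax; apply: kc; exact: Al.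
have [Ab|] := pselect (forall x, A x -> x <= b).
  have [k [c kc]] := P _ (mem_head _ _).
  exists k, c => x Ax; apply: kc.
  by have := Al _ Ax; rewrite /= !itv_boundlr => /andP[-> _] /=; rewrite bnd_simp Ab.
move/existsNP => [y /not_implyP[Ay /negP]]; rewrite -ltNge => yb.
apply: (IH (BLeft b)).
- by move=> c cs; apply: Av; rewrite inE cs orbT.
- move=> x Ax; rewrite in_itv/= andbT leNgt.
  by have := Av b (mem_head _ _) x y Ax Ay; rewrite yb andbT.
- by move=> I Is; apply: P; rewrite inE Is orbT.
Qed.

Lemma pieces_avoids (c : dyadic) s I b : path <%O c s ->
  I \in pieces (BLeft c) s -> b <= c \/ b \in s -> avoids [set` I] [:: b].
Proof.
elim: s c => [|d s IH] c /=.
  rewrite inE => _ /eqP -> [bc|//] b'; rewrite inE => /eqP -> x y /=.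
  rewrite !in_itv/= !andbT => cx _; apply/negP => /andP[xb _].
  by have := le_lt_trans (le_trans bc cx) xb; rewrite ltxx.
move=> /andP[cd ds]; rewrite inE => /orP[/eqP ->|Is] bs; last first.
  apply: (IH d) => //; case: bs => [bc|]; first by left; rewrite (le_trans bc)// ltW.
  by rewrite inE => /orP[/eqP ->|]; [left | right].
move=> b'; rewrite inE => /eqP -> x y /=.
rewrite !in_itv/= => /andP[cx _] /andP[_ yd]; apply/negP => /andP[xb by_].
case: bs => [bc|bs]; first by have := le_lt_trans (le_trans bc cx) xb; rewrite ltxx.
have db : d <= b.
  move: bs; rewrite inE => /orP[/eqP -> //|].
  by move: ds; rewrite lt_path_sortedE => /andP[/allP ad _] /ad /ltW.
by have := lt_le_trans by_ (le_trans yd db); rewrite ltxx.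
Qed.

Lemma piecewise_affineP g : piecewise_affine g <->
  exists s, forall A, avoids A s -> affine_on A g.
Proof.
split=> [[s _ P]|[s P]].
  by exists s => A As; apply: (pieces_cover As _ P) => x _; rewrite in_itv.
exists (sort <=%O (undup s)).
  by rewrite lt_sorted_uniq_le sort_uniq undup_uniq sort_le_sorted.
move=> I Is; apply: P => b bs.
have {bs} : b \in sort <=%O (undup s) by rewrite mem_sort mem_undup.
have : sorted <%O (sort <=%O (undup s)).
  by rewrite lt_sorted_uniq_le sort_uniq undup_uniq sort_le_sorted.
move: Is; case: (sort _ _) => [//|c t] /=.
rewrite inE => /orP[/eqP -> ct bs x y /=|Is ct bs]; last first.
  apply: (pieces_avoids ct Is _ (mem_head _ _)).
  by move: bs; rewrite inE => /orP[/eqP ->|]; [left|right].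
rewrite !in_itv/= => _ yc; apply/negP => /andP[_ by_].
have cb : c <= b.
  move: bs; rewrite inE => /orP[/eqP -> //|].
  by move: ct; rewrite lt_path_sortedE => /andP[/allP ad _] /ad /ltW.
by have := lt_le_trans by_ (le_trans yc cb); rewrite ltxx.
Qed.

Lemma thompson_group_closed : group_closed thompson_pred.
Proof.
have ltmono g : order_automorphism g -> {mono g : x y / x < y}.
  by move=> go; exact: leW_mono.
split.
- apply/asboolP; split=> //.
    exists [::] => // I _; exists 0, 0 => x _.
    by rewrite expr0z mul1r addr0.
  by exists 0, 0, 0; split=> x _; rewrite addr0.
- have inv_closed g : g \in thompson_pred -> (g^-1)%g \in thompson_pred.
    move=> /asboolP[go gp [a [m [n [gm gn]]]]]; apply/asboolP.
    have go' : order_automorphism (g^-1)%g.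
      by move=> x y; rewrite -go !symVK.
    split=> //.
      apply/piecewise_affineP; have [s P] := (piecewise_affineP g).1 gp.
      exists [seq g b | b <- s] => A As.
      have [|k [b kb]] := P [set x | A (g x)].
        move=> b bs x y /= Ax Ay; rewrite -(ltmono g go x) -(ltmono g go b).
        by apply: As => //; exact: map_f.
      exists (- k), (- (2%:Q ^ (- k) * b)) => x Ax.
      have := kb ((g^-1)%g x); rewrite /= symVK => /(_ Ax) ->.
      rewrite mulrDr addrK mulrA -expfzDr// addNr expr0z mul1r//.
    exists (Order.max (a - m%:~R) (a + n%:~R)), (- m), (- n); split=> x.
      rewrite dyadic_leE /= => xa; apply: (can_inj (symKV g)); rewrite symVK gm.
        by rewrite mulrNz subrK.
      rewrite dyadic_leE; move: xa; rewrite mulrNz.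
      have : val (a - m%:~R) <= val (Order.max (a - m%:~R) (a + n%:~R)).
        by rewrite -dyadic_leE le_max lexx.
      by rewrite !(raddfB, raddfN, raddfD)/=; lra.
    move=> xa; apply: (can_inj (symKV g)); rewrite symVK gn.
      by rewrite mulrNz subrK.
    move: xa; rewrite ge_max => /andP[_]; rewrite !dyadic_leE mulrNz.
    by rewrite !(raddfB, raddfN, raddfD)/=; lra.
  move=> g h gT /inv_closed; move: gT; move: (h^-1)%g => {}h.
  move=> /asboolP[go gp [a [m [n [gm gn]]]]].
  move=> /asboolP[ho hp [a' [m' [n' [hm hn]]]]]; apply/asboolP; split.
  - by move=> x y; rewrite !symME go ho.
  - apply/piecewise_affineP; have [s P] := (piecewise_affineP g).1 gp.
    have [t Q] := (piecewise_affineP h).1 hp.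
    exists (t ++ [seq (h^-1)%g b | b <- s]) => A As.
    have [|k [b kb]] := P [set h x | x in A].
      move=> b bs _ _ [x Ax <-] [y Ay <-].
      rewrite -[b](symVK h) !(ltmono _ ho); apply: As => //.
      by rewrite mem_cat map_f// orbT.
    have [|l [c lc]] := Q A.
      by move=> b' bt; apply: As; rewrite mem_cat bt.
    exists (k + l), (2%:Q ^ k * c + b) => x Ax.
    rewrite symME kb; last by exists x.
    by rewrite lc// expfzDr// mulrDr mulrA addrA.
  - exists (Order.max a' (Order.max (a + m'%:~R) (a - n'%:~R))), (m' + m), (n' + n).
    set M := Order.max _ _.
    have aM : val a' <= val M by rewrite -dyadic_leE !le_max lexx.
    have mM : val (a + m'%:~R) <= val M by rewrite -dyadic_leE !le_max lexx !orbT.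
    have nM : val (a - n'%:~R) <= val M by rewrite -dyadic_leE !le_max lexx !orbT.
    move: aM mM nM; rewrite !(raddfB, raddfN, raddfD)/= => aM mM nM.
    split=> x; rewrite dyadic_leE ?raddfN /= => xM.
      rewrite hm; last by rewrite dyadic_leE raddfN /=; lra.
      rewrite gm ?rmorphD ?addrA//.
      by rewrite dyadic_leE !(raddfB, raddfN, raddfD)/=; lra.
    rewrite hn; last by rewrite dyadic_leE /=; lra.
    rewrite gn ?rmorphD ?addrA//.
    by rewrite dyadic_leE !(raddfB, raddfN, raddfD)/=; lra.
Qed.

Record thompsonF := ThompsonF {
  thompsonF_val :> sym dyadic; _ : thompsonF_val \in thompson_pred }.

HB.instance Definition _ := [isSub for thompsonF_val].
HB.instance Definition _ := [Choice of thompsonF by <:].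
HB.instance Definition _ :=
  SubChoice_isSubGroup.Build (sym dyadic) thompson_pred thompsonF
    thompson_group_closed.

HB.instance Definition _ := Topological.copy thompsonF
  (initial_topology (thompsonF_val : thompsonF -> sym dyadic)).

Lemma thompsonF_val_continuous : continuous thompsonF_val.
Proof. exact: initial_continuous. Qed.

Lemma thompsonF_mulg_continuous :
  continuous (fun x : thompsonF * thompsonF => (x.1 * x.2)%g).
Proof.
apply: continuous_comp_initial => x.
apply: (@continuous_comp _ _ _
  (fun x : thompsonF * thompsonF => (x.1 : sym dyadic, x.2 : sym dyadic))
  (fun x : sym dyadic * sym dyadic => (x.1 * x.2)%g)); last exact: mulg_continuous.
case: x => x y U [[A B] [/= Ax By] ABU].
exists (thompsonF_val @^-1` A, thompsonF_val @^-1` B) => /=.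
  by split; exact: thompsonF_val_continuous.
by move=> [a b] [/= Aa Bb]; exact: ABU.
Qed.

Lemma thompsonF_invg_continuous : continuous (fun x : thompsonF => x^-1%g).
Proof.
apply: continuous_comp_initial => x.
apply: (@continuous_comp _ _ _ thompsonF_val (fun x : sym dyadic => x^-1%g)).
  exact: thompsonF_val_continuous.
exact: invg_continuous.
Qed.

HB.instance Definition _ := isTopologicalGroup.Build thompsonF
  thompsonF_mulg_continuous thompsonF_invg_continuous.

Lemma nbhs1_thompsonFP (U : set thompsonF) : nbhs (1%g : thompsonF) U <->
  exists s : seq dyadic,
    [set g : thompsonF | {in s, forall x, g x = x}] `<=` U.
Proof.
split=> [[_ [[V oV <-] V1] VU]|[s sU]].
  have [s sV] := (nbhs_symP _ _).1 (open_nbhs_nbhs (conj oV V1)).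
  by exists s => g gs; apply: VU; exact: sV.
apply: filterS sU _.
have sn : nbhs (thompsonF_val 1%g)
    [set g : sym dyadic | {in s, forall x, g x = x}].
  by apply/nbhs_symP; exists s.
exact: (thompsonF_val_continuous sn).
Qed.

(* Main.v *)
From HB Require Import structures.
Require Import Defs.
From mathcomp Require Import all_boot all_order all_algebra.
From mathcomp Require Import all_classical all_reals all_analysis.

(** Far to the right every element of Thompson's group is an integer
    translation, so a mean on F concentrated on far translations cannot tell
    left multiplication from a shift.

    Let t_k be the translation x |-> x + k.  A left-uniformly continuous f
    depends, up to a given error, only on the restriction of its argument to a
    finite set E of dyadics.  Suppose that g is translation by the integer n on
    [a, +oo[.  As soon as k is large enough for t_k to move E into [a, +oo[, the
    elements g t_k and t_(k+n) agree on E.  Hence f (g t_k) - f (t_(k+n)) tends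
    to 0 as k grows, and for any Banach limit LIM the functional
    f |-> LIM_k f (t_k) is an invariant mean:
    LIM_k f (g t_k) = LIM_k f (t_(k+n)) = LIM_k f (t_k).

    The Banach limit is the limit, along a free ultrafilter, of the arithmetic
    means.  The passage from the sequence (t_k) to a mean works in every
    topological group ([skew_amenable_of_sequence]); what is special to F is the
    agreement of g t_k with t_(k+n) on finite sets ([near_translation]). *)

Set Implicit Arguments.
Unset Strict Implicit.
Unset Printing Implicit Defensive.

Import Order.TTheory GRing.Theory Num.Theory.
Import numFieldNormedType.Exports.

Local Open Scope classical_set_scope.
Local Open Scope ring_scope.

Definition free_ultrafilter : set_system nat :=
  projT1 (cid (ultraFilterLemma eventually_filter)).

Lemma free_ultrafilterP : UltraFilter free_ultrafilter.
Proof. exact: (projT2 (cid (ultraFilterLemma eventually_filter))).1. Qed.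

Lemma eventually_free_ultrafilter : \oo `<=` free_ultrafilter.
Proof. exact: (projT2 (cid (ultraFilterLemma eventually_filter))).2. Qed.

#[local] Existing Instance free_ultrafilterP.

Lemma ultra_fmap (T U : Type) (f : T -> U) (F : set_system T) :
  UltraFilter F -> UltraFilter (f @ F).
Proof.
move=> FU; split; first exact: fmap_proper_filter.
move=> G GF fFG; apply/seteqP; split=> // A GA.
have [//|FAC] := in_ultra_setVsetC (f @^-1` A) FU.
have : G set0 by rewrite -(setICr A); apply: filterI => //; exact: fFG.
by move/filter_not_empty.
Qed.

Section BanachLimit.
Variable R : realType.
Implicit Types u v : R^nat.

Definition bounded_sequence u := exists M : R, forall n, `|u n| <= M.

(** The values stay in a segment, and on a compact set every ultrafilter
    converges. *)
Lemma ultra_map_cvg u : bounded_sequence u -> cvg (u @ free_ultrafilter).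
Proof.
move=> [M uM].
have := @segment_compact R (- M) M; rewrite compact_ultra.
have uI : (u @ free_ultrafilter) `[- M, M]%classic.
  apply: (@filterE _ free_ultrafilter) => n /=.
  by rewrite in_itv /= -ler_norml.
move=> /(_ _ (ultra_fmap u free_ultrafilterP) uI)[l [_ ul]].
by apply/cvg_ex; exists l.
Qed.

Lemma arithmetic_mean_bounded u :
  bounded_sequence u -> bounded_sequence (arithmetic_mean u).
Proof.
move=> [M uM]; exists M => n; rewrite /arithmetic_mean seriesEord /=.
rewrite normrM ger0_norm ?invr_ge0// ler_pdivrMl//.
apply: le_trans (ler_norm_sum _ _ _) _.
rewrite mulr_natl -[n.+1 in leRHS]card_ord -sumr_const.
by apply: ler_sum => i _.
Qed.

Lemma arithmetic_meanD u v :
  arithmetic_mean (u + v) = arithmetic_mean u + arithmetic_mean v.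
Proof.
apply/funext => n; rewrite /arithmetic_mean !seriesEord /= fctE.
by rewrite big_split mulrDr.
Qed.

Lemma arithmetic_meanZ a u : arithmetic_mean (a *: u) = a *: arithmetic_mean u.
Proof.
apply/funext => n; rewrite /arithmetic_mean !seriesEord /= fctE.
by rewrite -scaler_sumr -scalerAr.
Qed.

Definition banach_limit u := lim (arithmetic_mean u @ free_ultrafilter).

Lemma banach_limit_cvg u : bounded_sequence u ->
  arithmetic_mean u @ free_ultrafilter --> banach_limit u.
Proof. by move=> ub; apply: ultra_map_cvg; exact: arithmetic_mean_bounded. Qed.

Lemma banach_limit_linear a u v : bounded_sequence u -> bounded_sequence v ->
  banach_limit (a *: u + v) = a * banach_limit u + banach_limit v.
Proof.
move=> ub vb; apply: cvg_lim => //.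
rewrite arithmetic_meanD arithmetic_meanZ.
by apply: cvgD; [apply: cvgZr|]; exact: banach_limit_cvg.
Qed.

Lemma banach_limit_ge0 u : bounded_sequence u ->
  (forall n, 0 <= u n) -> 0 <= banach_limit u.
Proof.
move=> ub u0; apply: cvgr_to_ge (banach_limit_cvg ub) _.
apply: nearW => n; rewrite /arithmetic_mean seriesEord /=.
by rewrite mulr_ge0 ?invr_ge0// sumr_ge0.
Qed.

(** Arithmetic means have the same limits as the sequence itself, and the free
    ultrafilter refines convergence at infinity. *)
Lemma banach_limit_lim u l : u @ \oo --> l -> banach_limit u = l.
Proof.
move=> /cesaro ul; apply: cvg_lim => //.
by apply: cvg_trans ul; apply: cvg_app; exact: eventually_free_ultrafilter.
Qed.

Lemma banach_limit_cvg_sub0 u v : bounded_sequence u -> bounded_sequence v ->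
  arithmetic_mean (u - v) @ \oo --> 0 -> banach_limit u = banach_limit v.
Proof.
move=> ub vb uv0; apply/eqP; rewrite -subr_eq0; apply/eqP.
have <- : banach_limit (u - v) = 0.
  apply: cvg_lim => //; apply: cvg_trans uv0.
  by apply: cvg_app; exact: eventually_free_ultrafilter.
have -> : u - v = (-1) *: v + u by rewrite scaleN1r addrC.
by rewrite banach_limit_linear// mulN1r addrC.
Qed.

(** The difference of a sequence and its shift telescopes, so that its
    arithmetic means are O(1/n). *)
Lemma banach_limit_shift1 u : bounded_sequence u ->
  banach_limit (fun n => u n.+1) = banach_limit u.
Proof.
move=> [M uM]; apply: banach_limit_cvg_sub0; first by exists M.
  by exists M.
have -> : arithmetic_mean ((fun n => u n.+1) - u) =
    fun n => harmonic n * (u n.+1 - u 0).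
  apply/funext => n; rewrite /arithmetic_mean /=.
  by rewrite -[X in series X]/(telescope u) telescopeK.
apply/cvgr0Pnorm_le => e e0.
have : (fun n => harmonic n * (M + M)) @ \oo --> (0 * (M + M) : R).
  by apply: cvgMl; exact: cvg_harmonic.
rewrite mul0r => /cvgr0Pnorm_le/(_ e e0); apply: filterS => n.
apply: le_trans; rewrite !normrM ler_wpM2l//.
apply: le_trans (ler_normB _ _) _.
by rewrite (le_trans _ (ler_norm _))// lerD.
Qed.

Lemma banach_limit_shift u m : bounded_sequence u ->
  banach_limit (fun n => u (n + m)%N) = banach_limit u.
Proof.
move=> [M uM]; elim: m => [|m IH].
  by congr banach_limit; apply/funext => n; rewrite addn0.
rewrite -IH -[RHS]banach_limit_shift1; last by exists M.
by congr banach_limit; apply/funext => n; rewrite addnS addSn.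
Qed.

End BanachLimit.

Section InvariantMean.
Variables (R : realType) (G : topologicalGroupType) (t : nat -> G).
Implicit Type f : lucb R G.

Lemma lucb_comp_bounded f (s : nat -> G) : bounded_sequence (f \o s).
Proof. by have /asboolP[[M fM] _] := lucbP f; exists M => n; exact: fM. Qed.

Definition limit_mean f : R := banach_limit (f \o t).

Lemma limit_mean_scalar : scalar limit_mean.
Proof. by move=> a f h; rewrite -banach_limit_linear//; exact: lucb_comp_bounded. Qed.

HB.instance Definition _ :=
  GRing.isLinear.Build R (lucb R G) R *%R limit_mean limit_mean_scalar.

Lemma limit_mean_mean : mean limit_mean.
Proof.
split=> [f f0|].
  by apply: banach_limit_ge0 => [|n]; [exact: lucb_comp_bounded|exact: f0].
by apply: banach_limit_lim; exact: cvg_cst.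
Qed.

(** Left multiplication by g moves the sequence to an asymptotically equivalent
    shift of itself.  Two shift amounts stand for a single integer one, so that
    indices stay in [nat]. *)
Lemma skew_amenable_of_sequence :
  (forall g, exists m n, forall U, nbhs (1%g : G) U ->
     \forall k \near \oo, U ((g * t (k + m)%N)^-1 * t (k + n)%N)%g) ->
  skew_amenable R G.
Proof.
move=> shifts; exists limit_mean; first exact: limit_mean_mean.
move=> f g; have [m [n gmn]] := shifts g.
have fg_bounded := lucb_comp_bounded (lucb_comp_lambda g f) t.
rewrite /= /limit_mean.
rewrite -(banach_limit_shift m fg_bounded).
rewrite -(banach_limit_shift n (lucb_comp_bounded f t)).
apply: banach_limit_cvg_sub0.
- exact: (lucb_comp_bounded (lucb_comp_lambda g f) (fun k => t (k + m)%N)).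
- exact: (lucb_comp_bounded f (fun k => t (k + n)%N)).
apply: cesaro; apply/cvgr0Pnorm_le => e e0.
have /asboolP[_ /(_ e e0)[U U1 fU]] := lucbP f.
by apply: filterS (gmn U U1) => k /fU.
Qed.

End InvariantMean.

Section Translation.
Variable k : nat.

Lemma translation_bij : bijective (fun x : dyadic => x + k%:R).
Proof. by exists (fun x => x - k%:R) => x; rewrite ?addrK ?subrK. Qed.

Lemma translation_thompson : Sym (asboolT translation_bij) \in thompson_pred.
Proof.
apply/asboolP; split.
- by move=> x y; rewrite !dyadic_leE /= lerD2r.
- exists [::] => // I _; exists 0, (val (k%:R : dyadic)) => x _.
  by rewrite expr0z mul1r raddfD.
- by exists 0, k, k; split=> x _; rewrite -pmulrn.
Qed.

Definition translation : thompsonF := ThompsonF translation_thompson.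

End Translation.

Lemma val_dyadicDn (x : dyadic) k : val (x + k%:R) = val x + k%:R.
Proof. by rewrite raddfD; congr (_ + _); exact: rmorph_nat. Qed.

Lemma near_finite_ge (a : dyadic) (s : seq dyadic) :
  \forall k \near \oo, {in s, forall x, a <= x + k%:R}.
Proof.
elim: s => [|x s IH]; first by apply: nearW => k x.
have xa : \forall k \near \oo, val a - val x <= k%:R :> rat.
  apply: filterS (nbhs_infty_ge (Num.truncn (val a - val x)).+1) => k /= ak.
  by rewrite (le_trans (ltW (truncnS_gt _)))// ler_nat.
apply: filterS2 xa IH => k xk sk y; rewrite inE => /predU1P[->|]; last exact: sk.
by rewrite dyadic_leE val_dyadicDn -lerBlDl.
Qed.

(** Once the translation by [k + m] has moved the finite set [s] into the
    half-line on which [g] is a translation, [g] only changes the translation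
    amount, by the integer [n - m] that it adds near +oo. *)
Lemma near_translation (g : thompsonF) : exists m n, forall s : seq dyadic,
  \forall k \near \oo, {in s, forall x,
    g (translation (k + m) x) = translation (k + n) x}.
Proof.
have /asboolP[_ _ [a [_ [n [_ gn]]]]] := valP g.
(* A possibly negative [n] is split as [p - m], to be read as the two shifts. *)
have [m [p np]] : exists m p : nat, n = p%:Z - m%:Z.
  case: n gn => [p|m] _; first by exists 0, p; rewrite subr0.
  by exists m.+1, 0; rewrite NegzE sub0r.
exists m, p => s; apply: filterS (near_finite_ge a s) => k ak x xs /=.
rewrite gn; last first.
  rewrite natrD addrA (le_trans (ak x xs))// dyadic_leE.
  by rewrite (val_dyadicDn (_ + _)) lerDl.
by rewrite np rmorphB /= -!pmulrn !natrD -!addrA (addrC m%:R) subrK.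
Qed.

Theorem corollary9p2 (R : realType) : skew_amenable R thompsonF.
Proof.
apply: (@skew_amenable_of_sequence R thompsonF translation) => g.
have [m [n gmn]] := near_translation g; exists m, n.
move=> U /nbhs1_thompsonFP[s sU]; apply: filterS (gmn s) => k gk.
apply: sU => x xs; set h := (g * translation (k + m))%g.
exact: etrans (congr1 (val h)^-1%g (esym (gk x xs))) (symKV (val h) x).
Qed.
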